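(* Finiteness of rooted trees is not expressible as an existential monadic second order sentence: there is no EMSO $A$ such that, for every rooted tree $T\in\mathcal{T}$, $T$ satisfies $A$ if and only if $T$ is finite.
   Context: $\mathcal{T}$ is the space of all locally finite rooted trees (every node has finitely many children). Every tree $T$ has node set $V(T)$ and root $\phi$; $\pi(v)$ denotes the parent of a non-root node $v$. An existential monadic second order sentence (EMSO) on rooted trees is a sentence of the form $\exists S_1\cdots\exists S_n\,[P]$, where $n$ is a natural number, $S_1,\dots,S_n$ range over subsets of the set of nodes of the tree, and $P$ is a first-order sentence (quantifying over nodes) in the language with the root as a constant symbol, equality of nodes, the parent-child relation $\pi(v)=u$, and the membership relations $v\in S_i$. *)

(* Defs.v *)
From mathcomp Require Import all_boot.
From mathcomp Require Import boolp classical_sets functions cardinality.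

Set Implicit Arguments.
Unset Strict Implicit.
Unset Printing Implicit Defensive.

Local Open Scope classical_set_scope.

(* The nodes form an arbitrary type.  Since the root has no parent and every
   node is connected to the root by iterating [parent], there are no cycles and
   every non-root node has exactly one parent. *)
Record tree := Tree {
  node :> Type;
  root : node;
  parent : node -> option node;
  parent_root : parent root = None;
  to_root : forall v : node,
    exists k : nat, iter k (obind parent) (Some v) = Some root;
  locally_finite : forall u : node, finite_set [set v | parent v = Some u] }.

Arguments root {t}.
Arguments parent {t} v.

Definition finite_tree (T : tree) : Prop := finite_set [set: T].

(* Well-scoped de Bruijn syntax: [formula n k] has set variables S_i (i < n)
   and free node variables x_j (j < k); a quantifier binds x_0. *)
Inductive term (k : nat) : Type :=
| Root
| Var of 'I_k.

Inductive formula (n : nat) : nat -> Type :=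
| Eq k of term k & term k : formula n k
| Parent k of term k & term k : formula n k
| Mem k of term k & 'I_n : formula n k
| Not k of formula n k : formula n k
| And k of formula n k & formula n k : formula n k
| Or k of formula n k & formula n k : formula n k
| Imp k of formula n k & formula n k : formula n k
| Forall k of formula n k.+1 : formula n k
| Exists k of formula n k.+1 : formula n k.

Section Semantics.
Variable T : tree.

Definition eval_term k (e : 'I_k -> T) (t : term k) : T :=
  match t with Root => root | Var j => e j end.

Definition push k (v : T) (e : 'I_k -> T) : 'I_k.+1 -> T :=
  fun j => if unlift ord0 j is Some j' then e j' else v.

Fixpoint holds n (S : 'I_n -> set T) k (P : formula n k) :
    ('I_k -> T) -> Prop :=
  match P in formula _ k return ('I_k -> T) -> Prop with
  | Eq _ s t => fun e => eval_term e s = eval_term e t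
  (* [Parent s t] is the atom "the parent of s is t" *)
  | Parent _ s t => fun e => parent (eval_term e s) = Some (eval_term e t)
  | Mem _ t i => fun e => S i (eval_term e t)
  | Not _ Q => fun e => ~ holds S Q e
  | And _ Q R => fun e => holds S Q e /\ holds S R e
  | Or _ Q R => fun e => holds S Q e \/ holds S R e
  | Imp _ Q R => fun e => holds S Q e -> holds S R e
  | Forall _ Q => fun e => forall v : T, holds S Q (push v e)
  | Exists _ Q => fun e => exists v : T, holds S Q (push v e)
  end.

End Semantics.

(* The sentence "exists S_0 ... S_(n-1), P" with P first-order and closed. *)
Record emso := Emso { nsets : nat; matrix : formula nsets 0 }.

Definition satisfies (T : tree) (A : emso) : Prop :=
  exists S : 'I_(nsets A) -> set T,
    holds S (matrix A) (fun j : 'I_0 => root).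

(* Main.v *)
From mathcomp Require Import all_boot zify.
From mathcomp Require Import boolp classical_sets functions cardinality.
Require Import Defs.

Set Implicit Arguments.
Unset Strict Implicit.
Unset Printing Implicit Defensive.

(** A sentence that holds in all finite trees also holds in some infinite one;
    the trees that show this are spiders, i.e. roots carrying finitely many
    disjoint paths (legs).

    Let the first-order part have quantifier rank q, and take a spider with very
    many legs, all of the same finite but very large length.  It is finite, so
    some choice of the sets S_i satisfies the first-order part; these sets
    colour the nodes with finitely many colours.  By pigeonhole more than q legs
    carry one and the same coloured word w ([large_fiber]).  Since w is long,
    it has two positions a < b followed by the same factor of length about 2^q,
    so the segment of w between a and b can be repeated forever: the resulting
    infinite word looks, in every window of radius 2^q, like w around some
    position ([fold_agree]).  Attach to the spider one more leg, infinite, with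
    that colouring.  The result is locally finite and infinite.

    The two coloured trees satisfy the same sentences of quantifier rank q, by
    an Ehrenfeucht-Fraisse game of q rounds ([back_and_forth]).  With r rounds
    left Duplicator keeps windows of radius 2^r around corresponding pebbles
    equal, keeps pebbles at distance at most 2^r of each other at the same
    distance, and answers literally on the legs whose word is not w.  A move
    close to an old pebble is copied by translation; a move far from all of
    them is answered on a leg carrying w that bears no pebble yet, and there are
    more such legs than rounds ([coherent_extend]).  That the infinite leg has
    no leaf goes unnoticed, because w occurs on the other legs with its end. *)

(** * The Ehrenfeucht-Fraisse game *)

Fixpoint qrank n k (P : formula n k) : nat :=
  match P with
  | Eq _ _ _ | Parent _ _ _ | Mem _ _ _ => 0
  | Not _ Q => qrank Q
  | And _ Q R | Or _ Q R | Imp _ Q R => maxn (qrank Q) (qrank R)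
  | Forall _ Q | Exists _ Q => (qrank Q).+1
  end.

(** The parameter [r] of the relation [E] counts the rounds still to be played. *)
Lemma back_and_forth n (T T' : tree) (S : 'I_n -> set T) (S' : 'I_n -> set T')
    (E : nat -> forall k, ('I_k -> T) -> ('I_k -> T') -> Prop) :
  (forall r k (e : 'I_k -> T) (e' : 'I_k -> T') s t, E r k e e' ->
     (eval_term e s = eval_term e t <-> eval_term e' s = eval_term e' t) /\
     (parent (eval_term e s) = Some (eval_term e t) <->
      parent (eval_term e' s) = Some (eval_term e' t))) ->
  (forall r k (e : 'I_k -> T) (e' : 'I_k -> T') s i, E r k e e' ->
     (S i (eval_term e s) <-> S' i (eval_term e' s))) ->
  (forall r k (e : 'I_k -> T) (e' : 'I_k -> T'), E r.+1 k e e' ->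
     forall x, exists x', E r k.+1 (push x e) (push x' e')) ->
  (forall r k (e : 'I_k -> T) (e' : 'I_k -> T'), E r.+1 k e e' ->
     forall x', exists x, E r k.+1 (push x e) (push x' e')) ->
  forall k (P : formula n k) r e e', qrank P <= r -> E r k e e' ->
    (holds S P e <-> holds S' P e').
Proof.
move=> atomE memE forth back k P.
elim: P => {k} [k s t|k s t|k s i|k Q IH|k Q IHQ R IHR|k Q IHQ R IHR
               |k Q IHQ R IHR|k Q IH|k Q IH] r e e' /=.
- by move=> _ /(@atomE r k e e' s t) [].
- by move=> _ /(@atomE r k e e' s t) [].
- by move=> _ /(@memE r k e e' s i).
- by move=> rk /(IH _ _ _ rk) ->.
- by rewrite geq_max => /andP[rQ rR] Ee;
     rewrite (IHQ _ _ _ rQ Ee) (IHR _ _ _ rR Ee).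
- by rewrite geq_max => /andP[rQ rR] Ee;
     rewrite (IHQ _ _ _ rQ Ee) (IHR _ _ _ rR Ee).
- by rewrite geq_max => /andP[rQ rR] Ee;
     rewrite (IHQ _ _ _ rQ Ee) (IHR _ _ _ rR Ee).
- case: r => // r rk Ee; split=> H x.
  + by have [y Ey] := back _ _ _ _ Ee x; apply/(IH _ _ _ rk Ey).
  + by have [y Ey] := forth _ _ _ _ Ee x; apply/(IH _ _ _ rk Ey).
- case: r => // r rk Ee; split=> -[x Hx].
  + by have [y Ey] := forth _ _ _ _ Ee x; exists y; apply/(IH _ _ _ rk Ey).
  + by have [y Ey] := back _ _ _ _ Ee x; exists y; apply/(IH _ _ _ rk Ey).
Qed.

(** * Duplicator's strategy on families of words *)

Section Lines.
Variables (J A : Type).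
Implicit Types (w : J -> nat -> A) (x y : J * nat) (F : pred J).

(** [w] assigns a word to each index in [J], and a pair is a position in one of
    these words.  Positions before 0 are ignored: where the letter at 0 is
    recognizable, as on spiders, it forces the windows to be cut off alike. *)
Definition agree w w' d x x' := forall t t',
  t + x'.2 = t' + x.2 -> t <= x.2 + d -> x.2 <= t + d -> w x.1 t = w' x'.1 t'.

(** The indices satisfying [F] are the frozen ones, on which Duplicator has to
    answer every move by the same position. *)
Definition matched w w' F d x x' :=
  (F x.1 || F x'.1 -> x = x') /\ agree w w' d x x'.

(** If [x] and [y] are close on the same index, then so are [x'] and [y'], at the
    same signed distance, written without subtraction. *)
Definition near d x x' y y' :=
  x.1 = y.1 -> x.2 <= y.2 + d -> y.2 <= x.2 + d ->
  x'.1 = y'.1 /\ x.2 + y'.2 = y.2 + x'.2.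

Definition coherent w w' F d K (e e' : K -> J * nat) :=
  (forall a, matched w w' F d (e a) (e' a)) /\
  (forall a b, near d (e a) (e' a) (e b) (e' b) /\
               near d (e' a) (e a) (e' b) (e b)).

Lemma agree_center w w' d x x' : agree w w' d x x' -> w x.1 x.2 = w' x'.1 x'.2.
Proof. by apply; lia. Qed.

Lemma agree_sym w w' d x x' : agree w w' d x x' -> agree w' w d x' x.
Proof. by move=> ag t t' *; apply/esym/ag; lia. Qed.

Lemma agreeW w w' d d' x x' :
  d' <= d -> agree w w' d x x' -> agree w w' d' x x'.
Proof. by move=> led ag t t' *; apply: ag; lia. Qed.

(** Halving the radius pays for moving the centre of the window by [d]: this is
    why each round of the game halves the radius. *)
Lemma agree_shift w w' d x x' t t' :
  agree w w' d.*2 x x' -> t + x'.2 = t' + x.2 ->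
  t <= x.2 + d -> x.2 <= t + d -> agree w w' d (x.1, t) (x'.1, t').
Proof. by move=> ag E l1 l2 u u' /= *; apply: ag; lia. Qed.

Lemma matched_sym w w' F d x x' :
  matched w w' F d x x' -> matched w' w F d x' x.
Proof.
move=> [Fx /agree_sym ag]; split=> //.
by rewrite orbC => /Fx.
Qed.

Lemma matchedW w w' F d d' x x' :
  d' <= d -> matched w w' F d x x' -> matched w w' F d' x x'.
Proof. by move=> led [Fx /(agreeW led)]. Qed.

Lemma nearW d d' x x' y y' : d' <= d -> near d x x' y y' -> near d' x x' y y'.
Proof. by move=> led n e l1 l2; apply: n => //; lia. Qed.

Lemma near_sym d x x' y y' : near d x x' y y' -> near d y y' x x'.
Proof. by move=> n /esym e l1 l2; have [-> ?] := n e l2 l1; split=> //; lia. Qed.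

Lemma coherent_sym w w' F d K (e e' : K -> J * nat) :
  coherent w w' F d e e' -> coherent w' w F d e' e.
Proof.
by case=> [m n]; split=> [a|a b]; [exact: matched_sym | have [] := n a b].
Qed.

Lemma coherentW w w' F d d' K (e e' : K -> J * nat) : d' <= d ->
  coherent w w' F d e e' -> coherent w w' F d' e e'.
Proof.
move=> led [m n]; split=> [a|a b]; first exact: matchedW led (m a).
by have [? ?] := n a b; split; apply: nearW led _.
Qed.

(** A pebble on a frozen index is close only to pebbles on the same index, and
    those do not move either. *)
Lemma near_frozen w w' F d d' x y y' :
  F x.1 -> matched w w' F d' y y' -> near d x x y y' /\ near d x x y' y.
Proof.
move=> Fx [Fy _]; split=> e _ _.
  by rewrite -Fy; [split=> //; lia | rewrite -e Fx].
by rewrite Fy; [split=> //; lia | rewrite -e Fx orbT].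
Qed.

(** The map [h] names the pebbles of the extended position in terms of the old
    ones and of the new one, [None]; it covers the environments that arise from
    a quantifier as well as those that add the constant root. *)
Lemma coherent_add w w' F d K K' (h : K' -> option K) (e e' : K -> J * nat)
    (f f' : K' -> J * nat) x x' :
  coherent w w' F d e e' -> matched w w' F d x x' ->
  (forall a, near d x x' (e a) (e' a) /\ near d x' x (e' a) (e a)) ->
  (forall a, f a = oapp e x (h a)) -> (forall a, f' a = oapp e' x' (h a)) ->
  coherent w w' F d f f'.
Proof.
move=> [m n] mx nx fE f'E; split=> [a|a b]; rewrite !fE !f'E.
  by case: (h a).
case: (h a) (h b) => [a'|] [b'|] /=.
- exact: n.
- by have [? ?] := nx a'; split; apply: near_sym.
- exact: nx.
- by split=> _ _ _; split.
Qed.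

End Lines.

Section Extension.
Variables (J : eqType) (A : Type).
Implicit Types (w : J -> nat -> A) (x : J * nat) (F : pred J).

(** Every window of radius [d] centred at a present letter of an unfrozen word
    occurs on the other side, on an unfrozen index that avoids any [q - 1] given
    ones: it is the supply of answers to moves that are far from all pebbles. *)
Definition abundant (present : pred A) w w' F d q :=
  forall i t (s : seq J), ~~ F i -> present (w i t) -> size s < q ->
  exists i' t', [/\ ~~ F i', i' \notin s & agree w w' d (i, t) (i', t')].

Lemma abundantW (present : pred A) w w' F d d' q : d' <= d ->
  abundant present w w' F d q -> abundant present w w' F d' q.
Proof.
move=> led ab i t s Fi pt sq; have [i' [t' [? ? ag]]] := ab i t s Fi pt sq.
by exists i', t'; split=> //; apply: agreeW led ag.
Qed.

(** Duplicator's answer to a move [x].  On a frozen index it is [x] itself; close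
    to an old pebble [e a] it is the translate of [x] by which [e a] goes to
    [e' a]; otherwise it lies on an index without any pebble, hence far from
    all of them. *)
Lemma coherent_extend (zero present : pred A) w w' F q d p
    (e e' : 'I_p -> J * nat) x :
  (forall i t, zero (w i t) = (t == 0)) ->
  (forall i t, zero (w' i t) = (t == 0)) ->
  (forall i, F i -> w i =1 w' i) ->
  abundant present w w' F d q -> p < q ->
  coherent w w' F d.*2 e e' -> present (w x.1 x.2) ->
  exists x', matched w w' F d x x' /\
    forall a, near d x x' (e a) (e' a) /\ near d x' x (e' a) (e a).
Proof.
move=> z z' frozen ab ltpq [m n] px.
have [Fx|nFx] := boolP (F x.1).
  exists x; split.
    split=> // t t' E _ _; rewrite (frozen _ Fx); congr (w' _ _); lia.
  by move=> a; apply: near_frozen Fx (m a).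
have [[a [ea l1 l2]]|far] := pselect (exists a,
    [/\ x.1 = (e a).1, x.2 <= (e a).2 + d & (e a).2 <= x.2 + d]).
  have [Fa ag] := m a.
  have nFa : ~~ F (e' a).1.
    by apply: contra nFx => F'a; rewrite ea Fa // F'a orbT.
  (* Otherwise the position 0 of the second word would be seen from [e a] at a
     positive position of the first one. *)
  have ge0 : (e a).2 <= x.2 + (e' a).2.
    rewrite leqNgt; apply/negP => lt.
    have := ag ((e a).2 - (e' a).2) 0.
    move=> /(_ ltac:(lia) ltac:(lia) ltac:(lia)) ww.
    by have := z' (e' a).1 0; rewrite -ww z; lia.
  pose x' := ((e' a).1, x.2 + (e' a).2 - (e a).2).
  exists x'; split.
    split; first by rewrite (negPf nFx) (negPf nFa).
    have := agree_shift ag (t := x.2) (t' := x'.2).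
    by rewrite -ea -surjective_pairing; apply; rewrite //=; lia.
  move=> b; have [nab nba] := n a b; rewrite /x'; split=> /= exb k1 k2.
    have [||| <- ?] := nab; [by rewrite -ea|lia|lia|by split=> //=; lia].
  have [||| <- ?] := nba; [exact: exb|by move: k1 => /=; lia|
    by move: k2 => /=; lia|by split=> //=; lia].
have [|i' [t' [nFi i'e ag]]] :=
    ab x.1 x.2 [seq (e' a).1 | a <- enum 'I_p] nFx px.
  by rewrite size_map size_enum_ord.
exists (i', t'); split.
  by split; [rewrite (negPf nFx) (negPf nFi)|rewrite [x]surjective_pairing].
move=> a; split=> /=.
  by move=> ? ? ?; case: far; exists a.
by move=> /= E; case/negP: i'e; rewrite E (map_f (fun a => (e' a).1)) ?mem_enum.
Qed.

End Extension.

(** * Spiders *)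

Section Spider.
Variables (I : finType) (len : I -> option nat).

(** The leg [Some i] consists of the positions 1, 2, ..., up to [len i] if this is
    a number; the root is the position 0 of an index [None] of its own, so that
    in the game it is just a pebble on a frozen word. *)
Definition valid (p : option I * nat) : bool :=
  if p.1 is Some i then
    (0 < p.2) && (if len i is Some l then p.2 <= l else true)
  else p.2 == 0.

Definition spider_node := {p : option I * nat | valid p}.

Definition coord (v : spider_node) : option I * nat := val v.

Definition spider_root : spider_node := exist _ (None, 0) isT.

(** Coordinates without a node, such as the position 0 of a leg, denote the
    root. *)
Definition node_at (p : option I * nat) : spider_node := insubd spider_root p.

(** At position 1 this gives the root, by the convention of [node_at]. *)
Definition spider_parent (v : spider_node) : option spider_node :=
  if (coord v).1 is Some i then Some (node_at (Some i, (coord v).2.-1)) else None.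

Lemma coord_at p : valid p -> coord (node_at p) = p.
Proof. by move=> vp; rewrite /coord /node_at val_insubd vp. Qed.

Lemma coord_valid v : valid (coord v).
Proof. exact: valP. Qed.

Lemma coord_inj : injective coord.
Proof. exact: val_inj. Qed.

Lemma at_coord v : node_at (coord v) = v.
Proof. by apply: coord_inj; rewrite coord_at // coord_valid. Qed.

Lemma at0 i : node_at (i, 0) = spider_root.
Proof. by apply: coord_inj; rewrite /coord val_insubd; case: i. Qed.

Lemma at_invalid p : ~~ valid p -> node_at p = spider_root.
Proof. by move=> vp; apply: coord_inj; rewrite /coord val_insubd (negPf vp). Qed.

Lemma valid_pred i t : valid (Some i, t.+2) -> valid (Some i, t.+1).
Proof. by rewrite /valid /=; case: (len i) => //; lia. Qed.

Lemma spider_to_root v :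
  exists k, iter k (obind spider_parent) (Some v) = Some spider_root.
Proof.
case: v => -[[i|] t] vp; last first.
  by exists 0; congr Some; apply: val_inj => /=; congr pair; apply/eqP.
rewrite -[exist _ _ _]at_coord /=; elim: t vp => // -[|t] IH vp.
  by exists 1; rewrite /= /spider_parent coord_at //= at0.
have [k kP] := IH (valid_pred vp).
by exists k.+1; rewrite iterSr /= /spider_parent (coord_at vp) /=.
Qed.

Lemma spider_parentE v u : spider_parent v = Some u <->
  (coord v).1 <> None /\ ((coord v).2 = 1 /\ (coord u).1 = None \/
   (coord u).1 = (coord v).1 /\ (coord v).2 = (coord u).2.+1).
Proof.
case: v => -[[i|] t] vp; rewrite /spider_parent /=; last by split=> // -[].
have t0 : 0 < t by case/andP: vp.
split=> [[<-]|[_]].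
  split=> //; case: t t0 vp => // -[|t] _ vp /=; first by left; rewrite at0.
  by right; rewrite coord_at //; apply: valid_pred.
case=> -[].
  move=> -> u0 /=; rewrite at0; congr Some; apply: val_inj => /=.
  by case: u u0 => -[j s] /= vu ej; subst j; move/eqP: vu => /= ->.
move=> ui ->; rewrite /= -ui -surjective_pairing; congr Some.
exact: at_coord.
Qed.

Lemma spider_locally_finite (u : spider_node) :
  finite_set [set v | spider_parent v = Some u].
Proof.
have := @finite_image _ _ setT (fun i => node_at (i, (coord u).2.+1))
  (@finite_finset (option I) setT).
apply: sub_finite_set => v /= /spider_parentE [vn vu].
exists (coord v).1 => //; rewrite -[RHS]at_coord; congr node_at.
rewrite [RHS]surjective_pairing; congr pair.
case: vu => [[-> un]|[_ ->]] //.
by case: u un => -[j s] /= vu uj; subst j; move/eqP: vu => /= ->.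
Qed.

Definition spider : tree :=
  @Tree spider_node spider_root spider_parent erefl spider_to_root
    spider_locally_finite.

Lemma spider_finite N :
  (forall i, exists2 l, len i = Some l & l <= N) -> finite_tree spider.
Proof.
move=> lenN.
have := @finite_image _ _ setT
  (fun p : option I * 'I_N.+1 => node_at (p.1, val p.2))
  (@finite_finset (option I * 'I_N.+1)%type setT).
apply: sub_finite_set => v _.
have vN : (coord v).2 < N.+1.
  case: v => -[[i|] t] /= vp; last by move/eqP: vp => /= ->.
  by have [l il lN] := lenN i; move: vp; rewrite /valid /= il; lia.
by exists ((coord v).1, Ordinal vN) => //=; rewrite -surjective_pairing at_coord.
Qed.

Lemma spider_infinite i : len i = None -> ~ finite_tree spider.
Proof.
move=> il /(@finite_image _ _ _ (fun v : spider => (coord v).2)) fin.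
apply: infinite_nat; apply: sub_finite_set fin => t _.
have [->|t0] := posnP t; first by exists spider_root.
by exists (node_at (Some i, t)) => //; rewrite coord_at // /valid /= il t0.
Qed.

End Spider.

(** * The game on coloured spiders *)

(** The first two components, being the position 0 and being a node, make the two
    ends of a leg visible in a window; the third one is the colour. *)
Definition letter n := (bool * bool * {ffun 'I_n -> bool})%type.
Definition zero n (l : letter n) := l.1.1.
Definition present n (l : letter n) := l.1.2.

Definition word (I : finType) (len : I -> option nat) n
    (S : 'I_n -> set (spider len)) (i : option I) (t : nat) : letter n :=
  (t == 0, valid len (i, t), [ffun k => `[< S k (node_at len (i, t)) >]]).

Section Game.
Variables (I : finType) (len len' : I -> option nat) (n : nat).
Variables (S : 'I_n -> set (spider len)) (S' : 'I_n -> set (spider len')).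
Variable F : pred (option I).
Notation w := (word S).
Notation w' := (word S').

Let coh d K (e : K -> spider len) (e' : K -> spider len') :=
  coherent w w' F d (fun a => coord (e a)) (fun a => coord (e' a)).

(** The constant root counts as a pebble that is on the board from the start. *)
Lemma coherent_term d k (e : 'I_k -> spider len) (e' : 'I_k -> spider len') :
  F None -> (forall i, F i -> w i =1 w' i) ->
  coh d e e' -> coh d (@eval_term _ k e) (@eval_term _ k e').
Proof.
move=> FN frozen c; rewrite /coh.
apply: (coherent_add (h := fun s => if s is Var j then Some j else None) c
  (x := (None, 0)) (x' := (None, 0))) => [|a| |].
- by split=> // t t' E _ _; rewrite frozen //; congr (w' _ _); move: E => /=; lia.
- by apply: near_frozen FN (c.1 a).
- by case.
- by case.
Qed.

Lemma coherent_push d k (e : 'I_k -> spider len) (e' : 'I_k -> spider len')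
    (x : spider len) (x' : spider len') :
  coh d e e' -> matched w w' F d (coord x) (coord x') ->
  (forall a, near d (coord x) (coord x') (coord (e a)) (coord (e' a)) /\
             near d (coord x') (coord x) (coord (e' a)) (coord (e a))) ->
  coh d (push x e) (push x' e').
Proof.
move=> c mx nx; apply: (coherent_add (h := unlift ord0) c mx nx) => a;
  by rewrite /push; case: unlift.
Qed.

Lemma coherent_forth r q k (e : 'I_k -> spider len) (e' : 'I_k -> spider len')
    (x : spider len) :
  (forall i, F i -> w i =1 w' i) ->
  abundant (@present n) w w' F (2 ^ q) q -> r.+1 + k <= q ->
  coh (2 ^ r.+1) e e' -> exists x', coh (2 ^ r) (push x e) (push x' e').
Proof.
move=> frozen ab rkq c.
have px : present (w (coord x).1 (coord x).2).
  by rewrite /present /= -surjective_pairing; exact: coord_valid.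
have c2 : coh (2 ^ r).*2 e e'.
  by rewrite -mul2n -expnS.
have z (l0 : I -> option nat) (S0 : 'I_n -> set (spider l0)) i t :
  zero (word S0 i t) = (t == 0).
  by [].
have ab2 : abundant (@present n) w w' F (2 ^ r) q.
  by apply: abundantW ab; rewrite leq_exp2l //; lia.
have ltkq : k < q by lia.
have [y [my ny]] := coherent_extend (z _ S) (z _ S') frozen ab2 ltkq c2 px.
have vy : valid len' y.
  have := agree_center my.2; rewrite /word => -[_ + _].
  by rewrite -!surjective_pairing => <-; exact: coord_valid.
exists (node_at len' y); apply: coherent_push; rewrite ?coord_at //.
apply: coherentW c2; lia.
Qed.

End Game.

(** What a coherent position says about atomic formulas in two pebbles. *)
Section Atoms.
Variables (I : finType) (len len' : I -> option nat) (n : nat).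
Variables (S : 'I_n -> set (spider len)) (S' : 'I_n -> set (spider len')).
Variable F : pred (option I).
Notation w := (word S).
Notation w' := (word S').
Hypothesis FN : F None.

Variables (d : nat) (x y : spider_node len) (x' y' : spider_node len').
Hypotheses (mx : matched w w' F d (coord x) (coord x'))
  (my : matched w w' F d (coord y) (coord y'))
  (nxy : near d (coord x) (coord x') (coord y) (coord y')).

Lemma matched_mem k : S k x <-> S' k x'.
Proof.
have := agree_center mx.2; rewrite /word => -[_ _].
rewrite -!surjective_pairing !at_coord => /ffunP/(_ k); rewrite !ffunE => E.
by split=> /asboolP H; apply/asboolP; rewrite ?E // -?E.
Qed.

Lemma matched_eq : x = y -> x' = y'.
Proof.
move=> xy; have [||| e1 e2] := nxy; rewrite ?xy ?leq_addr //.
apply: val_inj; rewrite [LHS]surjective_pairing [RHS]surjective_pairing e1.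
by congr pair; move: e2; rewrite xy => /addnI ->.
Qed.

Lemma matched_parent : 0 < d ->
  spider_parent x = Some y -> spider_parent x' = Some y'.
Proof.
move=> d0 /spider_parentE[xN xy]; apply/spider_parentE.
have x'N : (coord x').1 <> None.
  by move=> E; apply: xN; rewrite mx.1 // E FN orbT.
split=> //; case: xy => [[x1 yN]|[yx xy]].
  left; split; last by rewrite -my.1 // yN FN.
  have x'0 : 0 < (coord x').2.
    have := coord_valid x'; rewrite /valid.
    by case: (coord x').1 x'N => // i _ /andP[].
  have := mx.2 0 (coord x').2.-1; rewrite x1 addn1 prednK //.
  move=> /(_ erefl isT d0)[] /esym/eqP x'1 _ _.
  by rewrite -(prednK x'0) x'1.
by right; have [//|||-> ?] := nxy; [lia | lia | split=> //; lia].
Qed.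

End Atoms.

(** The number of pebbles and the number of remaining rounds add up to at most
    the quantifier rank, so that abundance leaves an index without a pebble at
    each move. *)
Lemma spider_equiv (I : finType) (len len' : I -> option nat) n
    (S : 'I_n -> set (spider len)) (S' : 'I_n -> set (spider len'))
    (F : pred (option I)) (P : formula n 0) e e' :
  F None -> (forall i, F i -> word S i =1 word S' i) ->
  abundant (@present n) (word S) (word S') F (2 ^ qrank P) (qrank P) ->
  abundant (@present n) (word S') (word S) F (2 ^ qrank P) (qrank P) ->
  holds S P e <-> holds S' P e'.
Proof.
move=> FN frozen ab ab'; set q := qrank P in ab ab' *.
pose E r k (e : 'I_k -> spider len) (e' : 'I_k -> spider len') :=
  r + k <= q /\
  coherent (word S) (word S') F (2 ^ r)
    (fun a => coord (e a)) (fun a => coord (e' a)).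
have frozen' i : F i -> word S' i =1 word S i.
  by move=> Fi t; rewrite frozen.
apply: (@back_and_forth n _ _ S S' E _ _ _ _ 0 P q) => //; first last.
- by split; [rewrite addn0 | split=> [[]|[]]].
- move=> r k f f' [rk c] x'.
  have [x cx] := coherent_forth x' frozen' ab' rk (coherent_sym c).
  by exists x; split; [lia|exact: coherent_sym].
- move=> r k f f' [rk c] x.
  have [x' cx] := coherent_forth x frozen ab rk c.
  by exists x'; split; [lia|].
- move=> r k f f' s i [_ c].
  by have [m _] := coherent_term FN frozen c; exact: matched_mem (m s) _.
move=> r k f f' s t [_ c].
have [m nr] := coherent_term FN frozen c.
have [n1 n2] := nr s t.
have d0 : 0 < 2 ^ r by rewrite expn_gt0.
have [ms ms'] := (m s, matched_sym (m s)).
have [mt mt'] := (m t, matched_sym (m t)).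
split; split.
- exact: matched_eq n1.
- exact: matched_eq n2.
- exact: (matched_parent FN ms mt n1 d0).
- exact: (matched_parent FN ms' mt' n2 d0).
Qed.

(** * Pumping a leg *)

Lemma large_fiber (X Y : finType) (f : X -> Y) q :
  q * #|Y| < #|X| -> exists x0, q < #|[set x | f x == f x0]|.
Proof.
move=> ltX; apply: contrapT => small; move: ltX; rewrite ltnNge => /negP; apply.
rewrite -sum1_card (partition_big f predT) //= mulnC -sum_nat_const.
apply: leq_sum => y _; rewrite sum1_card.
have [x0 fx0|none] := pickP (fun x => f x == y); last first.
  by rewrite (eq_card none) card0.
rewrite leqNgt; apply/negP => gt; apply: small; exists x0.
by rewrite (eqP fx0) cardsE.
Qed.

Section Fold.
Variables (a b : nat).
Hypothesis ltab : a < b.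

(** The map that repeats the interval from [a] to [b - 1] forever. *)
Definition fold t := if t < b then t else a + (t - a) %% (b - a).

Lemma fold_small t : t < b -> fold t = t.
Proof. by rewrite /fold => ->. Qed.

Lemma fold_lt t : fold t < b.
Proof.
rewrite /fold; case: ifP => // _.
have : (t - a) %% (b - a) < b - a by rewrite ltn_mod subn_gt0.
lia.
Qed.

Lemma fold_gt0 t : 0 < a -> 0 < t -> 0 < fold t.
Proof. by rewrite /fold; case: ifP; lia. Qed.

Lemma fold_period t : a <= t -> fold (t + (b - a)) = fold t.
Proof.
move=> leat; rewrite /fold ifF; last by lia.
have -> : t + (b - a) - a = (t - a) + (b - a) by lia.
rewrite modnDr; case: ifP => // ltb.
by rewrite modn_small; lia.
Qed.

(** Within distance [2 * d] to the right of [b] the folded word still reads like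
    [w], because the factors at [a] and [b] agree.  A window centred to the right
    of [b + d] lies in the periodic part and can be shifted back by one period. *)
Lemma fold_agree (J A : Type) (w w' : J -> nat -> A) i i' d :
  (forall o, o <= d.*2 -> w i (a + o) = w i (b + o)) ->
  (forall t, w' i' t = w i (fold t)) ->
  forall j, exists j', agree w' w d (i', j) (i, j').
Proof.
move=> wab w'E.
have w'w t : t <= b + d.*2 -> w' i' t = w i t.
  elim/ltn_ind: t => t IH tb; have [ltb|leb] := ltnP t b.
    by rewrite w'E fold_small.
  have -> : t = a + (t - b) + (b - a) by lia.
  rewrite w'E fold_period ?leq_addr // -w'E IH; try lia.
  by rewrite wab; [congr (w _ _)|]; lia.
elim/ltn_ind=> j IH; have [lej|ltj] := leqP j (b + d).
  exists j => t t' /= E l1 l2; rewrite w'w; last by lia.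
  by congr (w _ _); lia.
have [|j' ag] := IH (j - (b - a)); first by lia.
exists j' => t t' /= E l1 l2.
have := ag (t - (b - a)) t'; rewrite /= => <-; try lia.
by rewrite !w'E -(@fold_period (t - (b - a))) ?subnK //; lia.
Qed.

End Fold.

(** [M] legs of length [N], and one more of length [l]: empty for [Some 0] and
    infinite for [None]. *)
Definition legs M N (l : option nat) (i : option 'I_M) : option nat :=
  if i is Some _ then Some N else l.

Section Pumping.
Variables (M N n : nat) (S : 'I_n -> set (spider (@legs M N (Some 0)))).
Variables (i0 : 'I_M) (a b : nat).
Hypotheses (a0 : 0 < a) (ltab : a < b) (leN : b <= N).

(** The colouring of the infinite leg is pulled back along the map that folds it
    onto the leg [i0]. *)
Definition retract (v : spider (@legs M N None)) : spider (@legs M N (Some 0)) :=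
  node_at _ (match coord v with
         | (Some None, t) => (Some (Some i0), fold a b t)
         | p => p
         end).

Definition pumped (k : 'I_n) : set (spider (@legs M N None)) :=
  [set v | S k (retract v)].

Lemma retract_root : retract root = root.
Proof. by rewrite /retract /= at0. Qed.

Lemma word_old i t :
  i <> Some None -> word pumped i t = word S i t.
Proof.
move=> iN; have vE :
    valid (@legs M N None) (i, t) = valid (@legs M N (Some 0)) (i, t).
  by case: i iN => [[i|]|].
rewrite /word vE; congr (_, _, _); apply/ffunP => k; rewrite !ffunE.
congr (`[< S k _ >]).
have [v|nv] := boolP (valid (@legs M N None) (i, t)); last first.
  by rewrite !at_invalid -?vE //; exact: retract_root.
by rewrite /retract coord_at //; case: i iN {vE v} => [[i|]|].
Qed.

Lemma word_new t :
  word pumped (Some None) t = word S (Some (Some i0)) (fold a b t).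
Proof.
have [->|t0] := posnP t.
  rewrite fold_small; last by lia.
  rewrite /word /=; congr (_, _, _); apply/ffunP => k; rewrite !ffunE.
  by rewrite !at0; congr (`[< S k _ >]); exact: retract_root.
have f0 := fold_gt0 ltab a0 t0; have fb := fold_lt ltab t.
have v : valid (@legs M N None) (Some None, t) by rewrite /valid /= t0.
rewrite /word v /valid /= f0 (leq_trans (ltnW fb) leN) /=.
rewrite [t == 0]eqn0Ngt [fold a b t == 0]eqn0Ngt t0 f0.
congr (_, _, _); apply/ffunP => k; rewrite !ffunE.
by rewrite /pumped /= /retract coord_at.
Qed.

End Pumping.

Lemma word_outside M N n (S : 'I_n -> set (spider (@legs M N (Some 0)))) i t :
  N < t -> word S (Some (Some i)) t =
    (false, false, [ffun k => `[< S k root >]]).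
Proof.
move=> ltN; have nv : ~~ valid (@legs M N (Some 0)) (Some (Some i), t).
  by rewrite /valid /= [t <= N]leqNgt ltN andbF.
rewrite /word (negPf nv); congr (_, _, _); first by lia.
by apply/ffunP => k; rewrite !ffunE at_invalid.
Qed.

(** The frozen indices are the root and the legs whose word differs from the
    frequent one, that of [i0]. *)
Lemma pump_spider n (P : formula n 0) M N
    (S : 'I_n -> set (spider (@legs M N (Some 0)))) :
  qrank P * #|{ffun 'I_N.+1 -> letter n}| < M ->
  #|{ffun 'I_(2 ^ qrank P).*2.+1 -> letter n}| < N ->
  exists S' : 'I_n -> set (spider (@legs M N None)),
    forall e e', holds S P e <-> holds S' P e'.
Proof.
set q := qrank P; set d := 2 ^ q => bigM bigN.
pose leg i : {ffun 'I_N.+1 -> letter n} :=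
  [ffun t : 'I_N.+1 => word S (Some (Some i)) t].
have legP i j : leg i = leg j -> word S (Some (Some i)) =1 word S (Some (Some j)).
  move=> /ffunP E t; have [ltN|leN] := ltnP N t; first by rewrite !word_outside.
  by have := E (Ordinal (leN : t < N.+1)); rewrite !ffunE.
have [i0 manyi0] : exists i0, q < #|[set i | leg i == leg i0]|.
  by apply: large_fiber; rewrite card_ord.
have fresh i (s : seq (option (option 'I_M))) : leg i = leg i0 -> size s < q ->
    exists i', [/\ leg i' == leg i0, Some (Some i') \notin s &
      word S (Some (Some i)) =1 word S (Some (Some i'))].
  move=> li sq; apply: contrapT => none.
  pose popular := [seq Some (Some i') | i' <- enum [set i' | leg i' == leg i0]].
  have : size popular <= size s.
    apply: uniq_leq_size => [|_ /mapP[i' + ->]].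
      by rewrite map_inj_uniq ?enum_uniq // => x y [].
    rewrite mem_enum inE => li'; apply/negPn/negP => si'.
    by apply: none; exists i'; split=> //; apply: legP; rewrite li (eqP li').
  by rewrite size_map -cardE; lia.
have [a [b [a0 ltab leN wab]]] : exists a b, [/\ 0 < a, a < b, b <= N &
    forall o, o <= d.*2 ->
      word S (Some (Some i0)) (a + o) = word S (Some (Some i0)) (b + o)].
  (* Positions are shifted by one to stay clear of the root. *)
  pose win (x : 'I_N) : {ffun 'I_d.*2.+1 -> letter n} :=
    [ffun o : 'I_d.*2.+1 => word S (Some (Some i0)) (x.+1 + o)].
  have /injectivePn[x [y xy E]] : ~~ injectiveb win.
    apply/negP => /injectiveP/leq_card; rewrite card_ord leqNgt; exact/negP/negPn.
  have {}E o : o <= d.*2 -> word S (Some (Some i0)) (x.+1 + o) =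
                          word S (Some (Some i0)) (y.+1 + o).
    by move=> lo; have /ffunP/(_ (Ordinal (lo : o < d.*2.+1))) := E;
      rewrite !ffunE.
  have [lxy|lyx|/val_inj exy] := ltngtP x y; last by rewrite exy eqxx in xy.
    by exists x.+1, y.+1; split.
  by exists y.+1, x.+1; split=> // o lo; rewrite E.
exists (pumped S i0 a b) => e e'.
pose F (j : option (option 'I_M)) :=
  match j with
  | Some (Some i) => leg i != leg i0
  | Some None => false
  | None => true
  end.
have new := word_new S i0 a0 ltab leN.
apply: (@spider_equiv _ _ _ n S (pumped S i0 a b) F) => //.
- by move=> [[i|]|] // _ t; rewrite word_old.
- move=> [[i|]|] //= t s; last by move=> _ /andP[]; lia.
  move=> /negPn/eqP li _ /(fresh i _ li)[i' [li' si' wE]].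
  exists (Some (Some i')), t; split=> /=; rewrite ?negbK //.
  by move=> u u' /= /addIn -> _ _; rewrite word_old.
- move=> [[i|]|] //= t s.
    move=> /negPn/eqP li _ /(fresh i _ li)[i' [li' si' wE]].
    exists (Some (Some i')), t; split=> /=; rewrite ?negbK //.
    by move=> u u' /= /addIn -> _ _; rewrite word_old.
  move=> _ _ /(fresh i0 _ erefl)[i' [li' si' wE]].
  have [t' ag] := fold_agree ltab wab new t.
  exists (Some (Some i')), t'; split=> /=; rewrite ?negbK //.
  by move=> u u' E l1 l2; rewrite (ag u u' E l1 l2) wE.
Qed.

Theorem mainTheorem2 :
  ~ exists A : emso, forall T : tree, satisfies T A <-> finite_tree T.
Proof.
move=> [[n P] sat].
pose N := #|{ffun 'I_(2 ^ qrank P).*2.+1 -> letter n}|.+1.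
pose M := (qrank P * #|{ffun 'I_N.+1 -> letter n}|).+1.
have [S SP] : satisfies (spider (@legs M N (Some 0))) (Emso P).
  by apply/sat; apply: (@spider_finite _ _ N) => -[i|]; eexists.
have [S' S'P] := @pump_spider n P M N S (ltnSn _) (ltnSn _).
apply: (@spider_infinite _ (@legs M N None) None) => //.
by apply/sat; exists S'; apply/S'P; exact: SP.
Qed.
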